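(* Consider the transmission of arbitrarily correlated sources $S_1$ and $S_2$ over the discrete memoryless MABRC with channel law $p(y,y_3|x_1,x_2,x_3)$, relay side information $W_3$ and receiver side information $W$, with joint law $p(s_1,s_2,w_3,w)$. Any achievable source-channel rate $\kappa$ must satisfy the constraints $$\begin{aligned} H(S_1|S_2,W) &\le \kappa I(X_1,X_3;Y|X_2),\\ H(S_2|S_1,W) &\le \kappa I(X_2,X_3;Y|X_1),\\ H(S_1,S_2|W) &\le \kappa I(X_1,X_2,X_3;Y), \end{aligned}$$ as well as the constraints $$\begin{aligned} H(S_1|S_2,W_3) &\le \kappa I(X_1;Y_3|X_2,X_3),\\ H(S_2|S_1,W_3) &\le \kappa I(X_2;Y_3|X_1,X_3),\\ H(S_1,S_2|W_3) &\le \kappa I(X_1,X_2;Y_3|X_3), \end{aligned}$$ for some input distribution $p(x_1,x_2,x_3)$, where $(Y,Y_3)$ is generated from $(X_1,X_2,X_3)$ through the channel law.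
   Context: Sources and side information. $\{(S_{1,k},S_{2,k},W_k,W_{3,k})\}_{k\ge 1}$ are i.i.d. across $k$ with joint law $p(s_1,s_2,w,w_3)$ on a finite alphabet $\mathcal S_1\times\mathcal S_2\times\mathcal W\times\mathcal W_3$, known to all nodes. Transmitter $i$ ($i=1,2$) observes $S_i^m$, the relay observes side information $W_3^m$, the receiver (destination) observes side information $W^m$. Channel. The channel has finite input alphabets $\mathcal X_1,\mathcal X_2,\mathcal X_3$ (transmitter 1, transmitter 2, relay), finite output alphabets $\mathcal Y$ (receiver), $\mathcal Y_3$ (relay), and is memoryless: for each $k=1,\dots,n$, the conditional law of $(Y_k,Y_{3,k})$ given all sources, side informations, inputs up to time $k$ and outputs up to time $k-1$ equals $p(y_k,y_{3,k}|x_{1,k},x_{2,k},x_{3,k})$. Codes. An $(m,n)$ source-channel code for the multiple-access broadcast relay channel (MABRC) consists of encoders $f_i^{(m,n)}:\mathcal S_i^m\to\mathcal X_i^n$, $i=1,2$; causal relay encoders with $x_{3,k}=f_{3,k}^{(m,n)}(y_{3,1}^{k-1},w_3^m)$, $1\le k\le n$; a receiver decoder $g^{(m,n)}:\mathcal Y^n\times\mathcal W^m\to\mathcal S_1^m\times\mathcal S_2^m$ with output $(\hat S_1^m,\hat S_2^m)$; and a relay decoder $g_3^{(m,n)}:\mathcal Y_3^n\times\mathcal W_3^m\to\mathcal S_1^m\times\mathcal S_2^m$ with output $(\tilde S_1^m,\tilde S_2^m)$. Its error probability is $P_e^{(m,n)}=\Pr\big\{\{(\hat S_1^m,\hat S_2^m)\ne(S_1^m,S_2^m)\}\cup\{(\tilde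 S_1^m,\tilde S_2^m)\neq(S_1^m,S_2^m)\}\big\}$. Achievability. A source-channel rate $\kappa$ is achievable if for every $\epsilon>0$ there is $m_0$ such that for all $m>m_0$, with $n=\lfloor\kappa m\rfloor$, there exists an $(m,n)$ code with $P_e^{(m,n)}<\epsilon$. *)

(* Defs.v *)
From mathcomp Require Import all_boot all_order all_algebra.
From mathcomp Require Import reals exp.

Set Implicit Arguments.
Unset Strict Implicit.
Unset Printing Implicit Defensive.

Import Order.TTheory GRing.Theory Num.Theory.
Local Open Scope ring_scope.

Record fdist (R : realType) (T : finType) := FDist {
  pmf :> T -> R;
  pmf_ge0 : forall t, 0 <= pmf t;
  pmf_sum1 : \sum_t pmf t = 1 }.

Arguments fdist R T%_type.

(* Random variables are functions on the finite sample space [T]. *)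
Notation "[% X , Y , .. , Z ]" := (fun t => (.. (X t, Y t) .., Z t))
  (at level 0, X at level 99, Y at level 99, Z at level 99) : ring_scope.

Section Information.
Variables (R : realType) (T : finType) (P : fdist R T).

Definition law (A : finType) (X : T -> A) (a : A) : R :=
  \sum_(t | X t == a) P t.

(* Information quantities are in nats. The conventions [0 * _ = 0], [x / 0 = 0]
   and [ln 0 = 0] make the terms of probability zero vanish. *)

(* H(X | Y) *)
Definition cond_entropy (A B : finType) (X : T -> A) (Y : T -> B) : R :=
  - \sum_a \sum_b
      law [% X, Y] (a, b) * ln (law [% X, Y] (a, b) / law Y b).

(* I(X ; Y) *)
Definition mutual_info (A B : finType) (X : T -> A) (Y : T -> B) : R :=
  \sum_a \sum_b
    law [% X, Y] (a, b) * ln (law [% X, Y] (a, b) / (law X a * law Y b)).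

(* I(X ; Y | Z) = H(X | Z) - H(X | Y, Z) *)
Definition cond_mutual_info (A B C : finType)
    (X : T -> A) (Y : T -> B) (Z : T -> C) : R :=
  cond_entropy X Z - cond_entropy X [% Y, Z].

End Information.

Section SingleLetterSource.
Variables S1 S2 W W3 : finType.
Implicit Type t : S1 * S2 * W * W3.

Definition srcS1 t := t.1.1.1.
Definition srcS2 t := t.1.1.2.
Definition srcW t := t.1.2.
Definition srcW3 t := t.2.

End SingleLetterSource.

Arguments srcS1 {S1 S2 W W3} t.
Arguments srcS2 {S1 S2 W W3} t.
Arguments srcW {S1 S2 W W3} t.
Arguments srcW3 {S1 S2 W W3} t.

Section SingleLetterChannel.
Variables X1 X2 X3 Y Y3 : finType.
Implicit Type t : (X1 * X2 * X3) * (Y * Y3).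

Definition inX1 t := t.1.1.1.
Definition inX2 t := t.1.1.2.
Definition inX3 t := t.1.2.
Definition outY t := t.2.1.
Definition outY3 t := t.2.2.

End SingleLetterChannel.

Arguments inX1 {X1 X2 X3 Y Y3} t.
Arguments inX2 {X1 X2 X3 Y Y3} t.
Arguments inX3 {X1 X2 X3 Y Y3} t.
Arguments outY {X1 X2 X3 Y Y3} t.
Arguments outY3 {X1 X2 X3 Y Y3} t.

Section InputOutput.
Variables (R : realType) (A B : finType).
Variables (px : fdist R A) (q : A -> fdist R B).

Let io_pmf (t : A * B) : R := px t.1 * q t.1 t.2.

Let io_ge0 t : 0 <= io_pmf t.
Proof. by rewrite mulr_ge0 ?pmf_ge0. Qed.

Let io_sum1 : \sum_t io_pmf t = 1.
Proof.
rewrite -(pair_bigA _ (fun a b => px a * q a b)) /= -(pmf_sum1 px).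
by apply: eq_bigr => a _; rewrite -mulr_sumr pmf_sum1 mulr1.
Qed.

(* Joint law of the input, drawn from [px], and the output of [q] on it. *)
Definition io_law : fdist R (A * B) := FDist io_ge0 io_sum1.

End InputOutput.

(* [T ^ n] is [{ffun 'I_n -> T}]; channel uses and source letters are numbered
   from 0. [past k y] is the block [y] before time [k]. *)
Definition past (T : Type) (n : nat) (k : 'I_n) (y : T ^ n) : T ^ k :=
  [ffun i : 'I_k => y (widen_ord (ltnW (ltn_ord k)) i)].

Record code (S1 S2 W W3 X1 X2 X3 Y Y3 : finType) (m n : nat) := Code {
  enc1 : S1 ^ m -> X1 ^ n;
  enc2 : S2 ^ m -> X2 ^ n;
  relay_enc : forall k : 'I_n, Y3 ^ k -> W3 ^ m -> X3;
  dec : Y ^ n -> W ^ m -> S1 ^ m * S2 ^ m;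
  relay_dec : Y3 ^ n -> W3 ^ m -> S1 ^ m * S2 ^ m }.

Section Transmission.
Variables (R : realType) (S1 S2 W W3 X1 X2 X3 Y Y3 : finType).
Variables (p : fdist R (S1 * S2 * W * W3)).
Variables (q : X1 * X2 * X3 -> fdist R (Y * Y3)).

Section Block.
Variables (m n : nat) (c : code S1 S2 W W3 X1 X2 X3 Y Y3 m n).

Definition block : finType :=
  (S1 ^ m * S2 ^ m * W ^ m * W3 ^ m * (Y ^ n * Y3 ^ n))%type.

Definition channel_input (s1 : S1 ^ m) (s2 : S2 ^ m) (w3 : W3 ^ m)
    (y3 : Y3 ^ n) (k : 'I_n) : X1 * X2 * X3 :=
  (enc1 c s1 k, enc2 c s2 k, relay_enc c (past k y3) w3).

(* Joint law of sources, side informations and channel outputs: the chain rule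
   over the channel uses, where the outputs at time [k] have conditional law [q]
   of the inputs at time [k], which depend only on the sources, the relay side
   information and the past relay outputs. *)
Definition block_law (t : block) : R :=
  let '(s1, s2, w, w3, (y, y3)) := t in
  (\prod_(i < m) p (s1 i, s2 i, w i, w3 i)) *
  (\prod_(k < n) q (channel_input s1 s2 w3 y3 k) (y k, y3 k)).

Definition decoding_error (t : block) : bool :=
  let '(s1, s2, w, w3, (y, y3)) := t in
  (dec c y w != (s1, s2)) || (relay_dec c y3 w3 != (s1, s2)).

Definition error_prob : R := \sum_(t | decoding_error t) block_law t.

End Block.

(* For [0 <= kappa], [Num.truncn (kappa * m%:R)] is the integer part. *)
Definition achievable (kappa : R) : Prop :=
  forall eps : R, 0 < eps -> exists m0 : nat, forall m : nat, (m0 < m)%N ->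
    exists c : code S1 S2 W W3 X1 X2 X3 Y Y3 m (Num.truncn (kappa * m%:R)),
      error_prob c < eps.

End Transmission.

(* Main.v *)
(** Fix a code.  Let [r] be the product of
    - [p(b) / p(a, b)] over the source letters, where [a] is the part of the
      source to be recovered and [b] the part known to the decoder,
    - [P(o | z) / q(o | x)] over the channel uses, where [o] is the output seen by
      the decoder, [z] the part of the input [x] that it can compute from [b] and
      past outputs, and [P] the joint law for the time-averaged input distribution,
    - a Fano-type guess of [a] given the decoder's data, which puts mass one half on
      the decoded value.
    Weighting the law of a run by [r] gives a subprobability: it draws [b], then the
    outputs [o] causally, then [a], then everything else from its conditional law.
    Hence the expectation of [ln r] is at most 0, which is the single-letter bound up
    to the Fano term.  No chain rule over time is needed, and averaging the inputs
    costs nothing because [P] is compared with the true law only inside [r].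
    The rate constraints then hold up to any positive error for some input
    distribution, hence exactly for one that maximizes the smallest slack, which is
    continuous on the compact simplex. *)
Require Import Defs.
From mathcomp Require Import all_boot all_order all_algebra.
From mathcomp Require Import boolp classical_sets topology normedtype derive.
From mathcomp Require Import reals exp realfun.
From mathcomp Require Import ring lra.

Set Implicit Arguments.
Unset Strict Implicit.
Unset Printing Implicit Defensive.

Import Order.TTheory GRing.Theory Num.Theory.
Import numFieldNormedType.Exports.
Local Open Scope ring_scope.

(** This is [ln r <= r - 1] taken in expectation. Both the nonnegativity of information and the
    converse rest on it. *)
Lemma expect_ln_le0 (R : realType) (I : finType) (P r : I -> R) :
  (forall i, 0 <= P i) -> (forall i, 0 < P i -> 0 < r i) ->
  \sum_i P i * r i <= \sum_i P i -> \sum_i P i * ln (r i) <= 0.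
Proof.
move=> P0 r0 le_Pr; apply: (@le_trans _ _ (\sum_i (P i * r i - P i))); last first.
  by rewrite sumrB subr_le0.
apply: ler_sum => i _; have := P0 i; rewrite le_eqVlt => /predU1P[<-|Pi0].
  by rewrite !mul0r subr0.
have := @le_ln1Dx R (r i - 1); rewrite [1 + _]addrC subrK => le_ln.
by rewrite -[X in _ - X]mulr1 -mulrBr ler_pM2l// le_ln//; have := r0 i Pi0; lra.
Qed.

(** * Causal kernels on finite sequences *)

Section FiniteSequences.

Definition map_ffun (n : nat) (S T : Type) (f : S -> T) (u : S ^ n) : T ^ n :=
  [ffun i => f (u i)].

Definition rcons_ffun (n : nat) (T : Type) (h : T ^ n) (v : T) : T ^ n.+1 :=
  [ffun i => if unlift ord_max i is Some j then h j else v].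

Lemma past_map_ffun (S T : Type) (n : nat) (k : 'I_n) (f : S -> T) (u : S ^ n) :
  past k (map_ffun f u) = map_ffun f (past k u).
Proof. by apply/ffunP => i; rewrite !ffunE. Qed.

Lemma rcons_ffun_widen (T : Type) (n : nat) (h : T ^ n) v (k : 'I_n) :
  rcons_ffun h v (widen_ord (leqnSn n) k) = h k.
Proof.
rewrite ffunE (_ : widen_ord _ k = lift ord_max k) ?liftK//.
by apply/val_inj; rewrite /= /bump leqNgt ltn_ord.
Qed.

Lemma rcons_ffun_last (T : Type) (n : nat) (h : T ^ n) v : rcons_ffun h v ord_max = v.
Proof. by rewrite ffunE unlift_none. Qed.

Lemma past_rcons_ffun_widen (T : Type) (n : nat) (h : T ^ n) v (k : 'I_n) :
  past (widen_ord (leqnSn n) k) (rcons_ffun h v) = past k h.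
Proof.
apply/ffunP => i; rewrite [LHS]ffunE [RHS]ffunE.
by rewrite -(rcons_ffun_widen h v); congr (rcons_ffun h v _); apply/val_inj.
Qed.

Lemma past_rcons_ffun_last (T : Type) (n : nat) (h : T ^ n) v :
  past ord_max (rcons_ffun h v) = h.
Proof.
apply/ffunP => i; rewrite [LHS]ffunE -[RHS](rcons_ffun_widen h v).
by congr (rcons_ffun h v _); apply/val_inj.
Qed.

Lemma sum_rcons_ffun (R : realType) (T : finType) (n : nat) (F : T ^ n.+1 -> R) :
  \sum_u F u = \sum_h \sum_v F (rcons_ffun h v).
Proof.
rewrite pair_bigA/= (reindex (fun w : T ^ n * T => rcons_ffun w.1 w.2))//.
exists (fun u : T ^ n.+1 => (past ord_max u, u ord_max)) => [[h v] _|u _] /=.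
  by rewrite past_rcons_ffun_last rcons_ffun_last.
apply/ffunP => i; rewrite [LHS]ffunE; case: unliftP => [j|] -> //.
by rewrite ffunE; congr (u _); apply/val_inj; rewrite /= /bump leqNgt ltn_ord.
Qed.

Lemma sum_pair_ffun (R : realType) (S T : finType) (n : nat)
    (F : (S * T)%type ^ n -> R) :
  \sum_u F u = \sum_(h : (S ^ n)%type) \sum_(v : (T ^ n)%type) F [ffun i => (h i, v i)].
Proof.
rewrite pair_bigA/= (reindex (fun w : S ^ n * T ^ n => [ffun i => (w.1 i, w.2 i)]))//.
exists (fun u => (map_ffun fst u, map_ffun snd u)) => [[h v] _|u _] /=.
  by congr pair; apply/ffunP => i; rewrite !ffunE.
by apply/ffunP => i; rewrite !ffunE -surjective_pairing.
Qed.

End FiniteSequences.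

Section CausalKernels.
Variables (R : realType) (U : finType).
Implicit Types n : nat.

(** Chain-rule form of a process law: [K k h v] stands for the probability of [v] at time [k] given
    the history [h]. An i.i.d. law is a kernel constant in [k] and [h]. *)
Definition causal_prod n (K : forall k : 'I_n, U ^ k -> U -> R) (u : U ^ n) : R :=
  \prod_(k < n) K k (past k u) (u k).

Lemma causal_prod_ge0 n (K : forall k : 'I_n, U ^ k -> U -> R) u :
  (forall k h v, 0 <= K k h v) -> 0 <= causal_prod K u.
Proof. by move=> K0; apply: prodr_ge0. Qed.

Lemma causal_prod_gt0 n (K : forall k : 'I_n, U ^ k -> U -> R) u :
  (forall k h v, 0 <= K k h v) -> 0 < causal_prod K u ->
  forall k, 0 < K k (past k u) (u k).
Proof.
move=> K0 /lt0r_neq0/prodf_neq0 Kn0 k.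
by rewrite lt_neqAle K0 eq_sym Kn0.
Qed.

Let init n (K : forall k : 'I_n.+1, U ^ k -> U -> R) (k : 'I_n) : U ^ k -> U -> R :=
  K (widen_ord (leqnSn n) k).

Let causal_prodS n (K : forall k : 'I_n.+1, U ^ k -> U -> R) h v :
  causal_prod K (rcons_ffun h v) = causal_prod (init K) h * K ord_max h v.
Proof.
rewrite /causal_prod big_ord_recr/= past_rcons_ffun_last rcons_ffun_last.
congr (_ * _); apply: eq_bigr => k _.
by rewrite rcons_ffun_widen past_rcons_ffun_widen.
Qed.

Lemma sum_causal_prod_le1 n (K : forall k : 'I_n, U ^ k -> U -> R) :
  (forall k h v, 0 <= K k h v) -> (forall k h, \sum_v K k h v <= 1) ->
  \sum_u causal_prod K u <= 1.
Proof.
elim: n K => [|n IHn] K K0 K1.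
  rewrite (eq_bigr (fun=> 1)) => [|u _]; last by rewrite /causal_prod big_ord0.
  by rewrite sumr_const card_ffun card_ord expn0.
have init0 k h v : 0 <= @init n K k h v by exact: K0.
rewrite sum_rcons_ffun; apply: le_trans (IHn (init K) init0 _); last first.
  by move=> k h; exact: K1.
apply: ler_sum => h _; under eq_bigr do rewrite causal_prodS.
by rewrite -mulr_sumr ler_piMr ?K1// causal_prod_ge0.
Qed.

Lemma sum_causal_prod n (K : forall k : 'I_n, U ^ k -> U -> R) :
  (forall k h, \sum_v K k h v = 1) -> \sum_u causal_prod K u = 1.
Proof.
elim: n K => [|n IHn] K K1.
  rewrite (eq_bigr (fun=> 1)) => [|u _]; last by rewrite /causal_prod big_ord0.
  by rewrite sumr_const card_ffun card_ord expn0.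
rewrite sum_rcons_ffun -(IHn (init K)) => [|k h]; last exact: K1.
apply: eq_bigr => h _; under eq_bigr do rewrite causal_prodS.
by rewrite -mulr_sumr K1 mulr1.
Qed.

(** The letters after time [k] sum out to one, after which the letter at time [k] can be averaged
    given its past. *)
Lemma sum_causal_prod_at n (K : forall k : 'I_n, U ^ k -> U -> R) (k : 'I_n)
    (G : U ^ k -> U -> R) :
  (forall k h, \sum_v K k h v = 1) ->
  \sum_u causal_prod K u * G (past k u) (u k) =
  \sum_u causal_prod K u * \sum_v K k (past k u) v * G (past k u) v.
Proof.
elim: n K k G => [|n IHn] K k G K1; first by case: k G.
rewrite !sum_rcons_ffun; case: (unliftP ord_max k) => [j kE|kE].
  have {kE}kE : k = widen_ord (leqnSn n) j.
    by rewrite kE; apply/val_inj; rewrite /= /bump leqNgt ltn_ord.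
  subst k.
  under eq_bigr => h _.
    under eq_bigr do rewrite causal_prodS rcons_ffun_widen past_rcons_ffun_widen mulrAC.
    rewrite -mulr_sumr K1 mulr1; over.
  rewrite (IHn (init K) j G) => [|j' h]; last exact: K1.
  apply: eq_bigr => h _.
  under [RHS]eq_bigr do rewrite causal_prodS past_rcons_ffun_widen mulrAC.
  by rewrite -mulr_sumr K1 mulr1.
subst k; apply: eq_bigr => h _.
under eq_bigr do rewrite causal_prodS rcons_ffun_last past_rcons_ffun_last -mulrA.
under [RHS]eq_bigr do rewrite causal_prodS past_rcons_ffun_last mulrAC.
by rewrite -!mulr_sumr K1 mulr1.
Qed.

(* The normalized kernel is the conditional law of [u] given its image under [o]. *)
Lemma sum_causal_prod_fiber n (K : forall k : 'I_n, U ^ k -> U -> R) (O : finType)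
    (o : U -> O) (f : O ^ n -> R) :
  (forall k h v, 0 <= K k h v) -> (forall x, 0 <= f x) ->
  \sum_u f (map_ffun o u) *
    causal_prod (fun k h v => K k h v / \sum_(w | o w == o v) K k h w) u <=
  \sum_x f x.
Proof.
move=> K0 f0; rewrite (partition_big (map_ffun o) predT)//=.
apply: ler_sum => x _.
(* [L] is [K] conditioned on the image [x k] at each time, and equals the normalized kernel on the
   fiber of [x]. Where [x k] has probability zero its mass is 0, so it is only a subprobability. *)
pose L (k : 'I_n) h v :=
  if o v == x k then K k h v / \sum_(w | o w == x k) K k h w else 0.
have L0 k h v : 0 <= L k h v.
  by rewrite /L; case: ifP => // _; rewrite divr_ge0// sumr_ge0.
have L1 k h : \sum_v L k h v <= 1.
  rewrite -big_mkcond/= -mulr_suml.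
  by have [->|?] := eqVneq (\sum_(w | o w == x k) K k h w) 0; rewrite ?mul0r// divff.
apply: (@le_trans _ _ (f x * \sum_u causal_prod L u)); last first.
  by rewrite ler_piMr// sum_causal_prod_le1.
rewrite mulr_sumr big_mkcond; apply: ler_sum => u _.
case: ifPn => [/eqP ux|_]; last by rewrite mulr_ge0// causal_prod_ge0.
rewrite le_eqVlt; apply/orP; left; apply/eqP; rewrite ux; congr (_ * _).
by apply: eq_bigr => k _; rewrite /L -ux ffunE eqxx.
Qed.

End CausalKernels.

(** * Information measures *)

Section Laws.
Variables (R : realType) (T : finType) (P : fdist R T).

Definition entropy (A : finType) (X : T -> A) : R :=
  - \sum_a law P X a * ln (law P X a).

Lemma law_ge0 (A : finType) (X : T -> A) a : 0 <= law P X a.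
Proof. by rewrite sumr_ge0// => t _; exact: pmf_ge0. Qed.

Lemma law_gt0 (A : finType) (X : T -> A) t : 0 < P t -> 0 < law P X (X t).
Proof.
move=> Pt; rewrite /law (bigD1 t)//= ltr_wpDr// sumr_ge0// => t' _.
exact: pmf_ge0.
Qed.

Lemma sum_law (A : finType) (X : T -> A) (f : A -> R) :
  \sum_a law P X a * f a = \sum_t P t * f (X t).
Proof.
rewrite [RHS](partition_big X predT)//=; apply: eq_bigr => a _.
by rewrite mulr_suml; apply: eq_bigr => t /eqP ->.
Qed.

Lemma eq_law (A B : finType) (X : T -> A) (Y : T -> B) a b :
  (forall t, (X t == a) = (Y t == b)) -> law P X a = law P Y b.
Proof. by move=> XY; apply: eq_bigl. Qed.

(** Points of probability zero drop out, so logarithms of quotients need splitting only where the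
    laws involved are positive. *)
Lemma eq_expect (f g : T -> R) :
  (forall t, 0 < P t -> f t = g t) -> \sum_t P t * f t = \sum_t P t * g t.
Proof.
move=> fg; apply: eq_bigr => t _.
by have := pmf_ge0 P t; rewrite le_eqVlt => /predU1P[<-|/fg->//]; rewrite !mul0r.
Qed.

Lemma entropyE (A : finType) (X : T -> A) :
  entropy X = - \sum_t P t * ln (law P X (X t)).
Proof. by rewrite /entropy (sum_law X (fun a => ln (law P X a))). Qed.

Lemma cond_entropyE (A B : finType) (X : T -> A) (Y : T -> B) :
  cond_entropy P X Y =
  - \sum_t P t * ln (law P [% X, Y] (X t, Y t) / law P Y (Y t)).
Proof.
rewrite /cond_entropy pair_bigA/=; congr (- _).
rewrite -(sum_law [% X, Y] (fun c => ln (law P [% X, Y] c / law P Y c.2))).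
by apply: eq_bigr => -[a b] _.
Qed.

Lemma cond_entropyB (A B : finType) (X : T -> A) (Y : T -> B) :
  cond_entropy P X Y = entropy [% X, Y] - entropy Y.
Proof.
rewrite cond_entropyE !entropyE -opprD -sumrB; congr (- _).
under [RHS]eq_bigr do rewrite -mulrBr.
apply: eq_expect => t Pt.
by rewrite ln_div ?posrE ?(law_gt0 Y)// (law_gt0 [% X, Y] Pt).
Qed.

Lemma cond_mutual_infoE (A B C : finType) (X : T -> A) (Y : T -> B) (Z : T -> C) :
  cond_mutual_info P X Y Z =
  \sum_t P t * ln ((law P [% X, [% Y, Z]] (X t, (Y t, Z t)) / law P [% X, Z] (X t, Z t))
                   / (law P [% Y, Z] (Y t, Z t) / law P Z (Z t))).
Proof.
rewrite /cond_mutual_info !cond_entropyE opprK addrC -sumrB.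
under eq_bigr do rewrite -mulrBr.
apply: eq_expect => t Pt.
have XYZ := law_gt0 [% X, [% Y, Z]] Pt; have YZ := law_gt0 [% Y, Z] Pt.
have XZ := law_gt0 [% X, Z] Pt; have Z0 := law_gt0 Z Pt.
rewrite /= in XYZ YZ XZ.
rewrite !ln_div ?posrE ?divr_gt0//; ring.
Qed.

(** Conditioning on a constant lets the unconditional information be treated like the conditional
    ones. *)
Lemma mutual_infoE (A B : finType) (X : T -> A) (Y : T -> B) :
  mutual_info P X Y = cond_mutual_info P X Y (fun=> tt).
Proof.
rewrite cond_mutual_infoE /mutual_info pair_bigA/=.
transitivity (\sum_c law P [% X, Y] c *
    ln (law P [% X, Y] c / (law P X c.1 * law P Y c.2))).
  by apply: eq_bigr => -[a b] _.
rewrite (sum_law [% X, Y] (fun c => ln (law P [% X, Y] c / _))).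
apply: eq_bigr => t _ /=; congr (_ * ln _).
have -> : law P (fun=> tt) tt = 1 by rewrite -(pmf_sum1 P); apply: eq_bigl.
rewrite (@eq_law _ _ [% X, [% Y, fun=> tt]] [% X, Y] _ (X t, Y t)); last first.
  by move=> t'; rewrite !xpair_eqE eqxx andbT.
rewrite (@eq_law _ _ [% X, fun=> tt] X _ (X t)); last first.
  by move=> t'; rewrite !xpair_eqE eqxx andbT.
rewrite (@eq_law _ _ [% Y, fun=> tt] Y _ (Y t)); last first.
  by move=> t'; rewrite !xpair_eqE eqxx andbT.
by rewrite divr1 invfM mulrA.
Qed.

Lemma sum_law_pair (A B : finType) (X : T -> A) (Y : T -> B) b :
  \sum_a law P [% X, Y] (a, b) = law P Y b.
Proof.
rewrite /law [RHS](partition_big X predT)//=; apply: eq_bigr => a _.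
by apply: eq_bigl => t; rewrite xpair_eqE andbC.
Qed.

Lemma sum_law1 (A : finType) (X : T -> A) : \sum_a law P X a = 1.
Proof.
under eq_bigr do rewrite -[law _ _ _]mulr1.
by rewrite (sum_law X (fun=> 1)) -[RHS](pmf_sum1 P); under eq_bigr do rewrite mulr1.
Qed.

Lemma cond_mutual_info_ge0 (A B C : finType) (X : T -> A) (Y : T -> B) (Z : T -> C) :
  0 <= cond_mutual_info P X Y Z.
Proof.
rewrite cond_mutual_infoE -oppr_le0 -sumrN.
(* Weighting the joint law by [r] makes [X] and [Y] independent given [Z]. *)
pose r d := (law P [% Y, Z] d.2 / law P Z d.2.2)
            / (law P [% X, [% Y, Z]] d / law P [% X, Z] (d.1, d.2.2)).
pose V := [% X, [% Y, Z]].
have r0 t : 0 < P t -> 0 < r (V t).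
  move=> Pt; rewrite /r/= !divr_gt0 ?(law_gt0 Z Pt) ?(law_gt0 V Pt)//.
    exact: (law_gt0 [% Y, Z] Pt).
  exact: (law_gt0 [% X, Z] Pt).
rewrite (eq_bigr (fun t => P t * - ln ((r (V t))^-1))); last first.
  by move=> t _; rewrite mulrN /r /V/= [in RHS]invf_div.
rewrite (@eq_expect _ (fun t => ln (r (V t)))); last first.
  by move=> t Pt; rewrite lnV ?posrE ?r0// opprK.
apply: expect_ln_le0 => //; first exact: pmf_ge0.
rewrite pmf_sum1 -(sum_law V r).
rewrite -(pair_bigA _ (fun a e => law P V (a, e) * r (a, e)))/= exchange_big/=.
rewrite -(sum_law1 [% Y, Z]); apply: ler_sum => -[b c] _.
apply: (@le_trans _ _
  (\sum_a law P [% Y, Z] (b, c) / law P Z c * law P [% X, Z] (a, c))).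
  apply: ler_sum => a _; rewrite /r/=.
  have [->|V0] := eqVneq (law P V (a, (b, c))) 0.
    by rewrite mul0r !mulr_ge0 ?invr_ge0 ?law_ge0.
  by rewrite invf_div mulrCA [law P V _ * _]mulrC divfK.
rewrite -mulr_sumr sum_law_pair.
have [->|Z0] := eqVneq (law P Z c) 0; first by rewrite mulr0 law_ge0.
by rewrite divfK.
Qed.

End Laws.

Lemma ln_prod (R : realType) (I : finType) (F : I -> R) :
  (forall i, 0 < F i) -> ln (\prod_i F i) = \sum_i ln (F i).
Proof.
move=> F0; elim: (index_enum I) => [|i s IHs]; first by rewrite !big_nil ln1.
by rewrite !big_cons lnM ?posrE ?prodr_gt0// IHs.
Qed.

(** * Information between a channel's input and output *)

Section ChannelInformation.
Variables (R : realType) (X U : finType) (px : fdist R X) (q : X -> fdist R U).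
Let P := io_law px q.

Lemma law_io (A O : finType) (f : X -> A) (o : U -> O) a y :
  law P (fun t => (f t.1, o t.2)) (a, y) =
  \sum_(x | f x == a) px x * law (q x) o y.
Proof.
rewrite /law.
under [RHS]eq_bigr do rewrite mulr_sumr.
by rewrite pair_big_dep/=; apply: eq_bigl => t; rewrite xpair_eqE.
Qed.

Lemma law_io_input (A : finType) (f : X -> A) a :
  law P (fun t => f t.1) a = \sum_(x | f x == a) px x.
Proof.
rewrite /law (eq_bigl (fun t => (f t.1 == a) && true)) => [|t]; last by rewrite andbT.
rewrite -(pair_big_dep (fun x => f x == a) (fun _ _ => true)
  (fun x u => px x * q x u))/=.
by apply: eq_bigr => x _; rewrite -mulr_sumr pmf_sum1 mulr1.
Qed.

(** As [f] and [z] together determine the input, the output given both follows the channel itself,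
    whatever [px] is. *)
Lemma io_cond_mutual_infoE (A O Z : finType) (f : X -> A) (o : U -> O) (z : X -> Z) :
  injective [% f, z] ->
  cond_mutual_info P (fun t => f t.1) (fun t => o t.2) (fun t => z t.1) =
  \sum_t P t * ln (law (q t.1) o (o t.2) /
    (law P (fun t => (o t.2, z t.1)) (o t.2, z t.1) / law P (fun t => z t.1) (z t.1))).
Proof.
move=> fz_inj; rewrite cond_mutual_infoE; apply: eq_expect => -[x u] /= Pt.
congr (ln (_ / _)).
have px0 : px x != 0 by apply: contraTneq Pt => px0; rewrite /= px0 mul0r ltxx.
rewrite (@law_io_input _ [% f, z]) (big_pred1 x) => [|x']; last first.
  exact: (inj_eq fz_inj x' x).
rewrite (@eq_law _ _ P _ _ _ (fun t => (t.1, o t.2)) _ (x, o u)); last first.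
  move=> t; have := inj_eq fz_inj t.1 x; rewrite /= !xpair_eqE => <-.
  by rewrite -!andbA; congr (_ && _); rewrite andbC.
by rewrite (@law_io _ _ id) (big_pred1 x)//= [px x * _]mulrC mulfK.
Qed.

End ChannelInformation.

(** * The converse for one decoder *)

Section Converse.
Variables (R : realType) (T X U : finType) (p : fdist R T) (q : X -> fdist R U).
Variables (m n : nat) (enc : forall k : 'I_n, T ^ m -> U ^ k -> X).

(** All encoders are merged into the single causal map [enc], and all sources and outputs into joint
    letters. A decoder will be specified by projections of these letters. *)
Definition run_law (t : T ^ m) (u : U ^ n) : R :=
  causal_prod (fun _ _ => p) t * causal_prod (fun k h => q (enc t h)) u.

Definition input_law (k : 'I_n) (x : X) : R :=
  \sum_t \sum_(u | enc t (past k u) == x) run_law t u.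

Let src_ge0 (t : T ^ m) : 0 <= causal_prod (fun _ _ => p) t :> R.
Proof. by apply: causal_prod_ge0 => *; exact: pmf_ge0. Qed.

Let src_sum1 : \sum_t causal_prod (fun (_ : 'I_m) _ => p) t = 1 :> R.
Proof. by apply: sum_causal_prod => *; exact: pmf_sum1. Qed.

Let chn_ge0 t (u : U ^ n) : 0 <= causal_prod (fun k h => q (enc t h)) u :> R.
Proof. by apply: causal_prod_ge0 => *; exact: pmf_ge0. Qed.

Let chn_sum1 t :
  \sum_(u : (U ^ n)%type) causal_prod (fun k h => q (enc t h)) u = 1 :> R.
Proof. by apply: sum_causal_prod => *; exact: pmf_sum1. Qed.

Lemma run_law_ge0 t u : 0 <= run_law t u.
Proof. exact: mulr_ge0. Qed.

Lemma sum_run_law : \sum_t \sum_u run_law t u = 1.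
Proof. by under eq_bigr do rewrite -mulr_sumr chn_sum1 mulr1. Qed.

Lemma expect_source (i : 'I_m) (f : T -> R) :
  \sum_t \sum_u run_law t u * f (t i) = \sum_s p s * f s.
Proof.
under eq_bigr => t _.
  under eq_bigr do rewrite mulrAC.
  rewrite -mulr_sumr chn_sum1 mulr1; over.
rewrite (@sum_causal_prod_at _ _ _ (fun _ _ => p) i (fun _ => f)) => [|*]; last first.
  exact: pmf_sum1.
by rewrite -mulr_suml src_sum1 mul1r.
Qed.

(** Memorylessness: given the sources and the past outputs, the output at time [k] has law [q] of
    the current input. *)
Lemma expect_channel (k : 'I_n) (g : X -> U -> R) :
  \sum_t \sum_u run_law t u * g (enc t (past k u)) (u k) =
  \sum_x input_law k x * \sum_v q x v * g x v.
Proof.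
under [RHS]eq_bigr do rewrite mulr_suml.
rewrite [RHS]exchange_big/=; apply: eq_bigr => t _.
under eq_bigr do rewrite -mulrA.
rewrite -mulr_sumr.
rewrite (@sum_causal_prod_at _ _ _ (fun k h => q (enc t h)) k
  (fun h => g (enc t h))) => [|*]; last exact: pmf_sum1.
rewrite mulr_sumr (partition_big (fun u => enc t (past k u)) predT)//=.
apply: eq_bigr => x _; rewrite mulr_suml.
by apply: eq_bigr => u /eqP ->; rewrite mulrA.
Qed.

Lemma input_law_ge0 k x : 0 <= input_law k x.
Proof. by do 2!(apply: sumr_ge0 => ? _); exact: run_law_ge0. Qed.

Lemma sum_input_law k : \sum_x input_law k x = 1.
Proof.
rewrite exchange_big/= -sum_run_law; apply: eq_bigr => t _.
by rewrite [RHS](partition_big (fun u => enc t (past k u)) predT).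
Qed.

Lemma input_law_gt0 k t u : 0 < run_law t u -> 0 < input_law k (enc t (past k u)).
Proof.
move=> tu0; rewrite /input_law (bigD1 t)//= ltr_wpDr//.
  by do 2!(apply: sumr_ge0 => ? _); exact: run_law_ge0.
rewrite (bigD1 u)//= ltr_wpDr//.
by apply: sumr_ge0 => ? _; exact: run_law_ge0.
Qed.

Section AverageInput.
Hypothesis n_gt0 : (0 < n)%N.

Let avg (x : X) : R := n%:R^-1 * \sum_k input_law k x.

Let avg_ge0 x : 0 <= avg x.
Proof. by rewrite mulr_ge0 ?invr_ge0// sumr_ge0// => k _; exact: input_law_ge0. Qed.

Let avg_sum1 : \sum_x avg x = 1.
Proof.
rewrite -mulr_sumr exchange_big/=.
under eq_bigr do rewrite sum_input_law.
by rewrite sumr_const card_ord mulVf// pnatr_eq0 -lt0n.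
Qed.

Definition avg_input : fdist R X := FDist avg_ge0 avg_sum1.

Lemma avg_inputE x : n%:R * avg_input x = \sum_k input_law k x.
Proof. by rewrite mulVKf// pnatr_eq0 -lt0n. Qed.

End AverageInput.

Section SideInformation.
Variables (A B O Z : finType) (a : T -> A) (b : T -> B) (o : U -> O) (z : X -> Z).
Variable side : forall k : 'I_n, B ^ m -> O ^ k -> Z.
Hypothesis side_enc : forall (k : 'I_n) t (h : U ^ k),
  z (enc t h) = side (map_ffun b t) (map_ffun o h).
(* Subconditional law of the source block given the decoder's data. *)
Variable guess : A ^ m -> B ^ m -> O ^ n -> R.
Hypothesis guess_gt0 : forall alpha beta eta, 0 < guess alpha beta eta.
Hypothesis guess_le1 : forall beta eta, \sum_alpha guess alpha beta eta <= 1.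
Variable px : fdist R X.
(** Stated without division by [n], so that the case [n = 0] is included. *)
Hypothesis px_avg : forall x, n%:R * px x = \sum_k input_law k x.

Let P := io_law px q.
Let lZ := law P (fun t => z t.1).
Let lOZ := law P (fun t => (o t.2, z t.1)).

(** Each output is drawn from [P(o | z)], with [z] recomputed from [beta] and the earlier outputs.
    The source part [a] does not enter, so it can be summed out first. *)
Let outker (beta : B ^ m) (eta : O ^ n) : R :=
  causal_prod (fun k h y => lOZ (y, side beta h) / lZ (side beta h)) eta.

Let srcB (beta : B ^ m) : R := causal_prod (fun _ _ => law p b) beta.

Let rsrc s : R := law p b (b s) / law p [% a, b] (a s, b s).
Let rchn x v : R := lOZ (o v, z x) / lZ (z x) / law (q x) o (o v).

Let ratio (t : T ^ m) (u : U ^ n) : R :=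
  (\prod_i rsrc (t i)) * (\prod_k rchn (enc t (past k u)) (u k))
  * guess (map_ffun a t) (map_ffun b t) (map_ffun o u).

Let outker_ge0 beta eta : 0 <= outker beta eta.
Proof. by apply: causal_prod_ge0 => *; rewrite divr_ge0// law_ge0. Qed.

Let guess_ge0 alpha beta eta : 0 <= guess alpha beta eta.
Proof. exact: ltW. Qed.

Let sum_outker beta : \sum_eta outker beta eta <= 1.
Proof.
apply: sum_causal_prod_le1 => [*|k h]; first by rewrite divr_ge0// law_ge0.
rewrite -mulr_suml /lOZ (sum_law_pair P (fun t => o t.2) (fun t => z t.1)) -/lZ.
by have [->|?] := eqVneq (lZ (side beta h)) 0; rewrite ?mul0r ?ler01// divff.
Qed.

(** The factor [q(u | x) / q(o | x)] that remains at each use is the conditional law of the full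
    output given the part the decoder sees. *)
Let channel_ratio t (u : U ^ n) :
  causal_prod (fun k h => q (enc t h)) u * \prod_k rchn (enc t (past k u)) (u k) =
  outker (map_ffun b t) (map_ffun o u) *
  causal_prod (fun k h v => q (enc t h) v / \sum_(w | o w == o v) q (enc t h) w) u.
Proof.
rewrite -!big_split/=; apply: eq_bigr => k _.
by rewrite /rchn side_enc past_map_ffun ffunE mulrCA.
Qed.

Let source_ratio (t : T ^ m) :
  causal_prod (fun _ _ => p) t * \prod_i rsrc (t i) =
  srcB (map_ffun b t) * causal_prod (fun _ _ s =>
    p s / \sum_(w | [% a, b] w == [% a, b] s) p w) t.
Proof.
rewrite -!big_split/=; apply: eq_bigr => k _.
by rewrite /rsrc ffunE mulrCA.
Qed.

Let run_ratio t u : run_law t u * ratio t u =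
  causal_prod (fun _ _ => p) t * (\prod_i rsrc (t i)) *
  (outker (map_ffun b t) (map_ffun o u) *
   guess (map_ffun a t) (map_ffun b t) (map_ffun o u) *
   causal_prod (fun k h v => q (enc t h) v / \sum_(w | o w == o v) q (enc t h) w) u).
Proof. by rewrite /run_law /ratio [X in _ = _ * X]mulrAC -channel_ratio; ring. Qed.

(** The variables are summed out in the reverse of the drawing order: [u] given its image under [o],
    [t] given its images under [a] and [b], then [alpha], [eta] and [beta]. *)
Let sum_ratio_le1 : \sum_t \sum_u run_law t u * ratio t u <= 1.
Proof.
pose F (g : (A * B)%type ^ m) := srcB (map_ffun snd g) *
  \sum_eta outker (map_ffun snd g) eta * guess (map_ffun fst g) (map_ffun snd g) eta.
have srcB_ge0 beta : 0 <= srcB beta by apply: causal_prod_ge0 => *; exact: law_ge0.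
have F0 g : 0 <= F g.
  by rewrite mulr_ge0// sumr_ge0// => eta _; rewrite mulr_ge0.
have map_pair1 (t : T ^ m) : map_ffun fst (map_ffun [% a, b] t) = map_ffun a t.
  by apply/ffunP => i; rewrite !ffunE.
have map_pair2 (t : T ^ m) : map_ffun snd (map_ffun [% a, b] t) = map_ffun b t.
  by apply/ffunP => i; rewrite !ffunE.
apply: (@le_trans _ _ (\sum_t F (map_ffun [% a, b] t) * causal_prod (fun _ _ s =>
    p s / \sum_(w | [% a, b] w == [% a, b] s) p w) t)).
  apply: ler_sum => t _; rewrite /F map_pair1 map_pair2 [leRHS]mulrAC -source_ratio.
  under [leLHS]eq_bigr do rewrite run_ratio.
  rewrite -mulr_sumr ler_wpM2l//.
    by rewrite mulr_ge0// prodr_ge0// => i _; rewrite divr_ge0// law_ge0.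
  apply: (@sum_causal_prod_fiber _ _ _ (fun k h => q (enc t h)) _ o
    (fun eta => outker (map_ffun b t) eta * guess (map_ffun a t) (map_ffun b t) eta)).
    by move=> *; exact: pmf_ge0.
  by move=> eta; rewrite mulr_ge0.
apply: le_trans (@sum_causal_prod_fiber _ _ _ (fun _ _ => p) _ [% a, b] F _ F0) _.
  by move=> *; exact: pmf_ge0.
rewrite sum_pair_ffun exchange_big/=.
apply: (@le_trans _ _ (\sum_beta srcB beta)); last first.
  by apply: sum_causal_prod_le1 => *; rewrite ?law_ge0 ?sum_law1.
apply: ler_sum => beta _.
have map1 (alpha : A ^ m) : map_ffun fst [ffun i => (alpha i, beta i)] = alpha.
  by apply/ffunP => i; rewrite !ffunE.
have map2 (alpha : A ^ m) : map_ffun snd [ffun i => (alpha i, beta i)] = beta.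
  by apply/ffunP => i; rewrite !ffunE.
under eq_bigr do rewrite /F map1 map2.
rewrite -mulr_sumr ler_piMr// exchange_big/=.
apply: le_trans (sum_outker beta); apply: ler_sum => eta _.
by rewrite -mulr_sumr ler_piMr.
Qed.

Let rchn_gt0 x v : 0 < P (x, v) -> 0 < rchn x v.
Proof.
move=> Pt; have q_gt0 : 0 < q x v.
  rewrite lt_neqAle pmf_ge0 andbT eq_sym.
  by apply: contraTneq Pt => /= ->; rewrite mulr0 ltxx.
rewrite /rchn !divr_gt0 ?(law_gt0 o q_gt0)//.
  exact: (law_gt0 (fun t => (o t.2, z t.1)) Pt).
exact: (law_gt0 (fun t => z t.1) Pt).
Qed.

Let factor_gt0 t u : 0 < run_law t u ->
  (forall i, 0 < rsrc (t i)) /\ forall k, 0 < rchn (enc t (past k u)) (u k).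
Proof.
move=> tu0; have tu_neq0 : run_law t u != 0 by rewrite gt_eqF.
move: (tu_neq0); rewrite mulf_eq0 negb_or => /andP[t_neq0 u_neq0].
have p_gt0 i : 0 < p (t i).
  apply: (@causal_prod_gt0 _ _ _ (fun _ _ => p)) => [*|]; first exact: pmf_ge0.
  by rewrite lt_neqAle eq_sym t_neq0 src_ge0.
have q_gt0 k : 0 < q (enc t (past k u)) (u k).
  apply: (@causal_prod_gt0 _ _ _ (fun k h => q (enc t h))) => [*|]; first exact: pmf_ge0.
  by rewrite lt_neqAle eq_sym u_neq0 chn_ge0.
split=> [i|k]; first by rewrite divr_gt0// ?(law_gt0 b)// (law_gt0 [% a, b]).
apply: rchn_gt0; rewrite mulr_gt0//=.
(* The averaged law charges the input used at time [k], since the term of index [k] in the average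
   does; [n] is positive because [k] exists. *)
rewrite -(@pmulr_rgt0 _ n%:R) ?px_avg; last first.
  by rewrite ltr0n; apply: leq_trans (ltn_ord k).
rewrite (bigD1 k)//= ltr_wpDr ?input_law_gt0// sumr_ge0// => k' _.
exact: input_law_ge0.
Qed.

(** The logarithm of [ratio] splits into three sums: the source factors average to [m H(a | b)], the
    channel factors to [- n I(f ; o | z)], and the guess leaves its logarithmic loss. *)
Lemma converse_bound (A' : finType) (f : X -> A') : injective [% f, z] ->
  m%:R * cond_entropy p a b <=
  n%:R * cond_mutual_info P (fun t => f t.1) (fun t => o t.2) (fun t => z t.1)
  + \sum_t \sum_u run_law t u *
      - ln (guess (map_ffun a t) (map_ffun b t) (map_ffun o u)).
Proof.
move=> fz_inj.
have E0 : \sum_t \sum_u run_law t u * ln (ratio t u) <= 0.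
  rewrite pair_bigA/=; apply: expect_ln_le0 => [[t u]|[t u]|] /=.
  - exact: run_law_ge0.
  - move=> tu0.
    have [rsrc0 rchn0] := factor_gt0 tu0.
    by rewrite /ratio !mulr_gt0 ?prodr_gt0.
  - by rewrite -(pair_bigA _ run_law)/= sum_run_law
      -(pair_bigA _ (fun t u => run_law t u * ratio t u)).
have srcE : m%:R * cond_entropy p a b =
    \sum_t \sum_u run_law t u * \sum_i ln (rsrc (t i)).
  under [RHS]eq_bigr do under eq_bigr do rewrite mulr_sumr.
  under [RHS]eq_bigr do rewrite exchange_big.
  rewrite exchange_big/=.
  under [RHS]eq_bigr do rewrite (expect_source _ (fun s => ln (rsrc s))).
  rewrite sumr_const card_ord -[RHS]mulr_natl cond_entropyE -sumrN.
  congr (_ * _).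
  under eq_bigr do rewrite -mulrN.
  apply: eq_expect => s s0; rewrite -lnV ?invf_div//.
  by rewrite posrE divr_gt0// ?(law_gt0 b s0)// (law_gt0 [% a, b] s0).
have chnE : n%:R *
    cond_mutual_info P (fun t => f t.1) (fun t => o t.2) (fun t => z t.1) =
    - \sum_t \sum_u run_law t u * \sum_k ln (rchn (enc t (past k u)) (u k)).
  under [in RHS]eq_bigr do under eq_bigr do rewrite mulr_sumr.
  under [in RHS]eq_bigr do rewrite exchange_big.
  rewrite exchange_big/=.
  (* [rchn] is the same at all times, so each use contributes a linear function of its input law,
     and the sum over time depends on the average alone. *)
  under [in RHS]eq_bigr do rewrite (expect_channel _ (fun x v => ln (rchn x v))).
  rewrite exchange_big/=.
  under [in RHS]eq_bigr do rewrite -mulr_suml -px_avg -mulrA mulr_sumr.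
  rewrite -mulr_sumr -mulrN; congr (_ * _).
  rewrite pair_bigA/= io_cond_mutual_infoE// -sumrN.
  transitivity (\sum_t P t * - ln (rchn t.1 t.2)); last first.
    by apply: eq_bigr => -[x v] _ /=; rewrite mulrN mulrA.
  by apply: eq_expect => -[x v] Pt; rewrite -lnV ?invf_div// posrE rchn_gt0.
rewrite srcE chnE.
rewrite -subr_le0; apply: le_trans E0; rewrite le_eqVlt; apply/orP; left; apply/eqP.
rewrite opprD opprK -!sumrN -!big_split/=; apply: eq_bigr => t _.
rewrite -!sumrN -!big_split/=; apply: eq_bigr => u _.
have := run_law_ge0 t u; rewrite le_eqVlt => /predU1P[<-|tu0].
  by rewrite !mul0r oppr0 !addr0.
have [rsrc0 rchn0] := factor_gt0 tu0.
rewrite /ratio !lnM ?posrE ?mulr_gt0 ?prodr_gt0// !ln_prod//; ring.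
Qed.

End SideInformation.

End Converse.

Lemma ln_nat_ge0 (R : realType) (k : nat) : 0 <= ln k%:R :> R.
Proof. by case: k => [|k]; [rewrite ln0 | rewrite ln_ge0// ler1n]. Qed.

(** * Fano's inequality through an explicit guess *)

Section DecoderConverse.
Variables (R : realType) (T X U : finType) (p : fdist R T) (q : X -> fdist R U).
Variables (m n : nat) (enc : forall k : 'I_n, T ^ m -> U ^ k -> X).

Lemma converse_decoder (A B O Z A' : finType) (a : T -> A) (b : T -> B)
    (o : U -> O) (z : X -> Z) (f : X -> A')
    (side : forall k : 'I_n, B ^ m -> O ^ k -> Z)
    (dec : O ^ n -> B ^ m -> A ^ m) (px : fdist R X) :
  (forall (k : 'I_n) t (h : U ^ k),
    z (enc t h) = side k (map_ffun b t) (map_ffun o h)) ->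
  injective [% f, z] ->
  (forall x, n%:R * px x = \sum_k input_law p q enc k x) ->
  m%:R * cond_entropy p a b <=
  n%:R * cond_mutual_info (io_law px q)
    (fun t => f t.1) (fun t => o t.2) (fun t => z t.1)
  + (ln 2 + (\sum_t \sum_(u | dec (map_ffun o u) (map_ffun b t) != map_ffun a t)
               run_law p q enc t u) * (m%:R * ln #|A|%:R)).
Proof.
move=> side_enc fz_inj px_avg.
pose N : R := #|{: A ^ m}|%:R.
(* [N] is zero when [A ^ m] is empty, so positivity is claimed in the presence of a block. *)
have N_gt0 (alpha : A ^ m) : 0 < N by rewrite ltr0n; apply/card_gt0P; exists alpha.
(* The loss is [ln 2] if decoding is correct and [ln 2 + m ln #|A|] otherwise. *)
pose guess alpha beta eta : R := (if alpha == dec eta beta then 1 else N^-1) / 2.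
have guess_gt0 alpha beta eta : 0 < guess alpha beta eta.
  by rewrite divr_gt0//; case: ifP => // _; rewrite invr_gt0 (N_gt0 alpha).
have guess_le1 beta eta : \sum_alpha guess alpha beta eta <= 1.
  rewrite -mulr_suml (bigD1 (dec eta beta))//= eqxx.
  rewrite (eq_bigr (fun=> N^-1)) => [|alpha /negPf ->//].
  rewrite ler_pdivrMr// mul1r -[2]/(1 + 1) lerD2l.
  apply: (@le_trans _ _ (\sum_(alpha : (A ^ m)%type) N^-1)).
    rewrite [leRHS](bigD1 (dec eta beta))//= ler_wpDl// invr_ge0.
    exact/ltW/N_gt0/(dec eta beta).
  by rewrite sumr_const -mulr_natl divff// gt_eqF// (N_gt0 (dec eta beta)).
apply: le_trans (converse_bound a side_enc guess_gt0 guess_le1 px_avg fz_inj) _.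
rewrite lerD2l.
have -> : ln 2 = \sum_t \sum_u run_law p q enc t u * ln 2 :> R.
  by under eq_bigr do rewrite -mulr_suml; rewrite -mulr_suml sum_run_law mul1r.
rewrite mulr_suml -big_split/=; apply: ler_sum => t _.
rewrite mulr_suml [X in _ + X]big_mkcond -big_split/=; apply: ler_sum => u _.
rewrite /guess eq_sym; case: eqVneq => [_|_] /=.
  by rewrite addr0 div1r lnV ?posrE// opprK.
rewrite -mulrDr ler_wpM2l ?run_law_ge0//.
have A_gt0 := N_gt0 (map_ffun a t).
rewrite lnM ?posrE ?invr_gt0// !lnV ?posrE// opprD !opprK addrC lerD2l.
rewrite /N card_ffun card_ord natrX in A_gt0 *.
(* For [m = 0] the block space has one element even if [A] is empty; otherwise its nonemptiness
   forces [A] to be nonempty. *)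
have [->|m_gt0] := posnP m; first by rewrite expr0 ln1 mul0r.
rewrite lnXn ?mulr_natl// lt_neqAle ler0n andbT.
by apply: contraTneq A_gt0 => <-; rewrite expr0n gtn_eqF// ltxx.
Qed.

End DecoderConverse.

(** * Codes with a decoding relay *)

Section CodeRun.
Variables (R : realType) (S1 S2 W W3 X1 X2 X3 Y Y3 : finType).
Variables (p : fdist R (S1 * S2 * W * W3)).
Variables (q : X1 * X2 * X3 -> fdist R (Y * Y3)).
Variables (m n : nat) (c : code S1 S2 W W3 X1 X2 X3 Y Y3 m n).

Definition code_enc (k : 'I_n) (t : (S1 * S2 * W * W3)%type ^ m)
    (h : (Y * Y3)%type ^ k) : X1 * X2 * X3 :=
  (enc1 c (map_ffun srcS1 t) k, enc2 c (map_ffun srcS2 t) k,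
   relay_enc c (map_ffun snd h) (map_ffun srcW3 t)).

Definition code_error t u : bool :=
  let s12 := (map_ffun srcS1 t, map_ffun srcS2 t) in
  (dec c (map_ffun fst u) (map_ffun srcW t) != s12) ||
  (relay_dec c (map_ffun snd u) (map_ffun srcW3 t) != s12).

(** Regrouping a tuple of blocks as a block of tuples is a bijection that preserves each factor of
    the law. *)
Lemma error_probE :
  error_prob p q c = \sum_t \sum_(u | code_error t u) run_law p q code_enc t u.
Proof.
rewrite pair_big_dep/= /error_prob.
rewrite (reindex (fun tu : ((S1 * S2 * W * W3)%type ^ m * (Y * Y3)%type ^ n) =>
  (map_ffun srcS1 tu.1, map_ffun srcS2 tu.1, map_ffun srcW tu.1, map_ffun srcW3 tu.1,
   (map_ffun fst tu.2, map_ffun snd tu.2)) : block S1 S2 W W3 Y Y3 m n))/=.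
  apply: eq_bigr => -[t u] _; congr (_ * _); apply: eq_bigr => i _.
    by rewrite !ffunE -!surjective_pairing.
  by rewrite /channel_input past_map_ffun !ffunE -surjective_pairing.
exists (fun d : block S1 S2 W W3 Y Y3 m n =>
  let '(s1, s2, w, w3, (y, y3)) := d in
  ([ffun i => (s1 i, s2 i, w i, w3 i)], [ffun k => (y k, y3 k)])).
  move=> [t u] _ /=.
  by congr pair; apply/ffunP => i; rewrite !ffunE -!surjective_pairing.
move=> [[[[s1 s2] w] w3] [y y3]] _ /=.
by do !congr pair; apply/ffunP => i; rewrite !ffunE.
Qed.

(** [dec'] may recover only part of the sources or use extra data: it need only be right whenever
    the code is, so its error event lies inside that of the code. *)
Lemma converse_code (A B O Z A' : finType) (a : S1 * S2 * W * W3 -> A)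
    (b : S1 * S2 * W * W3 -> B) (o : Y * Y3 -> O) (z : X1 * X2 * X3 -> Z)
    (f : X1 * X2 * X3 -> A') (side : forall k : 'I_n, B ^ m -> O ^ k -> Z)
    (dec' : O ^ n -> B ^ m -> A ^ m) (px : fdist R (X1 * X2 * X3)) :
  (forall x, n%:R * px x = \sum_k input_law p q code_enc k x) ->
  (forall t u, ~~ code_error t u ->
    dec' (map_ffun o u) (map_ffun b t) = map_ffun a t) ->
  (forall (k : 'I_n) t (h : (Y * Y3)%type ^ k),
    z (code_enc t h) = side k (map_ffun b t) (map_ffun o h)) ->
  injective [% f, z] ->
  m%:R * cond_entropy p a b <=
  n%:R * cond_mutual_info (io_law px q)
    (fun t => f t.1) (fun t => o t.2) (fun t => z t.1)
  + (ln 2 + error_prob p q c * (m%:R * ln #|A|%:R)).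
Proof.
move=> px_avg dec_ok side_enc fz_inj.
apply: le_trans (converse_decoder a dec' side_enc fz_inj px_avg) _.
rewrite !lerD2l ler_wpM2r//.
  by rewrite mulr_ge0 ?ln_nat_ge0.
rewrite error_probE; apply: ler_sum => t _.
rewrite [leLHS]big_mkcond [leRHS]big_mkcond; apply: ler_sum => u _.
have [_|/dec_ok ->] := ifPn (code_error t u); last by rewrite eqxx.
by case: ifP => // _; exact: run_law_ge0.
Qed.

End CodeRun.

(** * The six constraints up to a small error *)

Section Region.
Variables (R : realType) (S1 S2 W W3 X1 X2 X3 Y Y3 : finType).
Variables (p : fdist R (S1 * S2 * W * W3)).
Variables (q : X1 * X2 * X3 -> fdist R (Y * Y3)).
Variable kappa : R.
Hypothesis kappa_ge0 : 0 <= kappa.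

(** Taking one minimum over the six constraints makes a single maximizing input law serve them
    all. *)
Definition slack (px : fdist R (X1 * X2 * X3)) : R :=
  let P := io_law px q in
  Num.min
   (Num.min (kappa * cond_mutual_info P [% inX1, inX3] outY inX2
               - cond_entropy p srcS1 [% srcS2, srcW])
   (Num.min (kappa * cond_mutual_info P [% inX2, inX3] outY inX1
               - cond_entropy p srcS2 [% srcS1, srcW])
            (kappa * mutual_info P [% inX1, inX2, inX3] outY
               - cond_entropy p [% srcS1, srcS2] srcW)))
   (Num.min (kappa * cond_mutual_info P inX1 outY3 [% inX2, inX3]
               - cond_entropy p srcS1 [% srcS2, srcW3])
   (Num.min (kappa * cond_mutual_info P inX2 outY3 [% inX1, inX3]
               - cond_entropy p srcS2 [% srcS1, srcW3])
            (kappa * cond_mutual_info P [% inX1, inX2] outY3 inX3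
               - cond_entropy p [% srcS1, srcS2] srcW3))).


(** Division by [m]; nonnegativity of [I] allows [n] to be replaced by its upper bound
    [kappa * m]. *)
Lemma converse_rate (m n : nat) (H I E delta : R) :
  (0 < m)%N -> n%:R <= kappa * m%:R -> 0 <= I -> E <= delta * m%:R ->
  m%:R * H <= n%:R * I + E -> - delta <= kappa * I - H.
Proof.
move=> m_gt0 le_n I0 le_E le_H; rewrite lerBrDl lerBlDr.
have m_gt0' : 0 < m%:R :> R by rewrite ltr0n.
rewrite -(ler_pM2l m_gt0'); apply: le_trans le_H _.
by rewrite mulrDr mulrCA mulrA [m%:R * delta]mulrC lerD// ler_wpM2r.
Qed.

(** [converse_code] is applied six times with the same [px]. In the constraints on one source the
    decoder is also given the other source, hence that transmitter's input. The relay recomputes its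
    own input from its past outputs and [w3], so [x3] is conditioned upon; for the receiver [x3]
    stays among the informative inputs. *)
Lemma slack_code (m n : nat) (c : code S1 S2 W W3 X1 X2 X3 Y Y3 m n)
    (px : fdist R (X1 * X2 * X3)) (delta : R) :
  (forall x, n%:R * px x = \sum_k input_law p q (code_enc c) k x) ->
  (0 < m)%N -> n%:R <= kappa * m%:R ->
  ln 2 + error_prob p q c * (m%:R * ln #|S1|%:R) <= delta * m%:R ->
  ln 2 + error_prob p q c * (m%:R * ln #|S2|%:R) <= delta * m%:R ->
  ln 2 + error_prob p q c * (m%:R * ln #|{: S1 * S2}|%:R) <= delta * m%:R ->
  - delta <= slack px.
Proof.
move=> px_avg m_gt0 le_n E1 E2 E12.
have err_dec t u : ~~ code_error c t u ->
    dec c (map_ffun fst u) (map_ffun srcW t) = (map_ffun srcS1 t, map_ffun srcS2 t).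
  by rewrite negb_or negbK => /andP[/eqP].
have err_relay t u : ~~ code_error c t u ->
    relay_dec c (map_ffun snd u) (map_ffun srcW3 t) =
    (map_ffun srcS1 t, map_ffun srcS2 t).
  by rewrite negb_or !negbK => /andP[_ /eqP].
have map_snd (S V V' : finType) k (f : S -> V) (g : S -> V') (t : S ^ k) :
    map_ffun snd (map_ffun [% f, g] t) = map_ffun g t.
  by apply/ffunP => i; rewrite !ffunE.
have map_fst (S V V' : finType) k (f : S -> V) (g : S -> V') (t : S ^ k) :
    map_ffun fst (map_ffun [% f, g] t) = map_ffun f t.
  by apply/ffunP => i; rewrite !ffunE.
have map_pair (S V V' : finType) k (f : S -> V) (g : S -> V') (t : S ^ k) :
    [ffun i => (map_ffun f t i, map_ffun g t i)] = map_ffun [% f, g] t.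
  by apply/ffunP => i; rewrite !ffunE.
rewrite /slack mutual_infoE !le_min; do !(apply/andP; split).
- apply: (converse_rate m_gt0 le_n (cond_mutual_info_ge0 _ _ _ _) E1).
  apply: (@converse_code _ _ _ _ _ _ _ _ _ _ p q m n c _ _ _ _ _ srcS1 [% srcS2, srcW]
    fst (fun x => x.1.2) (fun x => (x.1.1, x.2))
    (fun k g _ => enc2 c (map_ffun fst g) k)
    (fun y g => (dec c y (map_ffun snd g)).1)) => //.
  + by move=> t u /err_dec; rewrite map_snd => ->.
  + by move=> k t h; rewrite map_fst.
  + by move=> [[x1 x2] x3] [[x1' x2'] x3'] [-> -> ->].
- apply: (converse_rate m_gt0 le_n (cond_mutual_info_ge0 _ _ _ _) E2).
  apply: (@converse_code _ _ _ _ _ _ _ _ _ _ p q m n c _ _ _ _ _ srcS2 [% srcS1, srcW]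
    fst (fun x => x.1.1) (fun x => (x.1.2, x.2))
    (fun k g _ => enc1 c (map_ffun fst g) k)
    (fun y g => (dec c y (map_ffun snd g)).2)) => //.
  + by move=> t u /err_dec; rewrite map_snd => ->.
  + by move=> k t h; rewrite map_fst.
  + by move=> [[x1 x2] x3] [[x1' x2'] x3'] [-> -> ->].
(* No input is recomputed from [W] and the past of [Y], so the known part [z] is constant. *)
- apply: (converse_rate m_gt0 le_n (cond_mutual_info_ge0 _ _ _ _) E12).
  apply: (@converse_code _ _ _ _ _ _ _ _ _ _ p q m n c _ _ _ _ _ [% srcS1, srcS2] srcW
    fst (fun=> tt) (fun x => (x.1.1, x.1.2, x.2)) (fun _ _ _ => tt)
    (fun y g => [ffun i => ((dec c y g).1 i, (dec c y g).2 i)])) => //.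
  + by move=> t u /err_dec ->; exact: map_pair.
  + by move=> [[x1 x2] x3] [[x1' x2'] x3'] [-> -> ->].
- apply: (converse_rate m_gt0 le_n (cond_mutual_info_ge0 _ _ _ _) E1).
  apply: (@converse_code _ _ _ _ _ _ _ _ _ _ p q m n c _ _ _ _ _ srcS1 [% srcS2, srcW3]
    snd (fun x => (x.1.2, x.2)) (fun x => x.1.1)
    (fun k g h => (enc2 c (map_ffun fst g) k, relay_enc c h (map_ffun snd g)))
    (fun y g => (relay_dec c y (map_ffun snd g)).1)) => //.
  + by move=> t u /err_relay; rewrite map_snd => ->.
  + by move=> k t h; rewrite map_fst map_snd.
  + by move=> [[x1 x2] x3] [[x1' x2'] x3'] [-> -> ->].
- apply: (converse_rate m_gt0 le_n (cond_mutual_info_ge0 _ _ _ _) E2).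
  apply: (@converse_code _ _ _ _ _ _ _ _ _ _ p q m n c _ _ _ _ _ srcS2 [% srcS1, srcW3]
    snd (fun x => (x.1.1, x.2)) (fun x => x.1.2)
    (fun k g h => (enc1 c (map_ffun fst g) k, relay_enc c h (map_ffun snd g)))
    (fun y g => (relay_dec c y (map_ffun snd g)).2)) => //.
  + by move=> t u /err_relay; rewrite map_snd => ->.
  + by move=> k t h; rewrite map_fst map_snd.
  + by move=> [[x1 x2] x3] [[x1' x2'] x3'] [-> -> ->].
- apply: (converse_rate m_gt0 le_n (cond_mutual_info_ge0 _ _ _ _) E12).
  apply: (@converse_code _ _ _ _ _ _ _ _ _ _ p q m n c _ _ _ _ _ [% srcS1, srcS2] srcW3
    snd (fun x => x.2) (fun x => (x.1.1, x.1.2)) (fun k g h => relay_enc c h g)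
    (fun y g => [ffun i => ((relay_dec c y g).1 i, (relay_dec c y g).2 i)])) => //.
  + by move=> t u /err_relay ->; exact: map_pair.
  + by move=> [[x1 x2] x3] [[x1' x2'] x3'] [-> -> ->].
Qed.

Hypotheses (X1_nonempty : (0 < #|X1|)%N) (X2_nonempty : (0 < #|X2|)%N)
           (X3_nonempty : (0 < #|X3|)%N).

Lemma slack_achievable (delta : R) : achievable p q kappa -> 0 < delta ->
  exists px : fdist R (X1 * X2 * X3), - delta <= slack px.
Proof.
move=> ach delta0.
(* A common bound on the three logarithmic alphabet sizes; the added 1 makes it positive, so that it
   can be divided by. *)
pose L : R := ln #|S1|%:R + ln #|S2|%:R + ln #|{: S1 * S2}|%:R + 1.
have [L1 L2 L12] : [/\ ln #|S1|%:R <= L, ln #|S2|%:R <= L & ln #|{: S1 * S2}|%:R <= L].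
  have := ln_nat_ge0 R #|S1|; have := ln_nat_ge0 R #|S2|.
  by have := ln_nat_ge0 R #|{: S1 * S2}|; rewrite /L; split; lra.
have L0 : 0 < L.
  by rewrite ltr_wpDl// !addr_ge0 ?ln_nat_ge0.
have eps0 : 0 < delta / 2 / L by rewrite !divr_gt0.
have [m0 codes] := ach _ eps0.
(* The choice of error probability bounds the error term by [delta / 2] per source letter, and this
   [m] is large enough for [ln 2] to take at most the other half. *)
pose m := (m0 + Num.bound (ln 2 / (delta / 2))).+1.
have [c err_lt] := codes m (leq_addr _ _ : (m0 < m)%N).
have m0' : 0 < m%:R :> R by rewrite ltr0n.
have ln2_le : ln 2 <= delta / 2 * m%:R.
  rewrite mulrC -ler_pdivrMr ?divr_gt0//; apply/ltW/(lt_le_trans (archi_boundP _)).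
    by rewrite !divr_ge0 ?ln_nat_ge0// ltW.
  by rewrite ler_nat; apply: leqW; exact: leq_addl.
have err_ge0 : 0 <= error_prob p q c.
  by rewrite error_probE; do 2!(apply: sumr_ge0 => ? _); exact: run_law_ge0.
have bound A : A <= L ->
    ln 2 + error_prob p q c * (m%:R * A) <= delta * m%:R.
  move=> AL; rewrite [delta]splitr mulrDl lerD// mulrCA mulrC ler_pM2r//.
  apply: le_trans (ler_wpM2l err_ge0 AL) _.
  by rewrite -ler_pdivlMr// ltW.
suff [px px_avg] : exists px : fdist R (X1 * X2 * X3), forall x,
    (Num.truncn (kappa * m%:R))%:R * px x = \sum_k input_law p q (code_enc c) k x.
  exists px; apply: (slack_code px_avg) => //; try exact: bound.
  by rewrite truncn_le// mulr_ge0.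
(* Without channel uses the averaging condition is void and any input law will do. *)
have [n_gt0|n_eq0] := ltnP 0 (Num.truncn (kappa * m%:R)).
  by exists (avg_input p q (code_enc c) n_gt0) => x; exact: avg_inputE.
have /card_gt0P[x1 _] := X1_nonempty; have /card_gt0P[x2 _] := X2_nonempty.
have /card_gt0P[x3 _] := X3_nonempty; pose x0 := (x1, x2, x3).
have dirac_ge0 x : 0 <= (x == x0)%:R :> R by rewrite ler0n.
have dirac_sum1 : \sum_x (x == x0)%:R = 1 :> R.
  by rewrite (bigD1 x0)//= eqxx big1 ?addr0// => x /negPf ->.
exists (FDist dirac_ge0 dirac_sum1) => x.
move: n_eq0 c {err_lt err_ge0 bound}; rewrite leqn0 => /eqP -> c.
by rewrite mul0r big_ord0.
Qed.

End Region.

(** * Attaining the best slack *)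

Section Continuity.
Local Open Scope classical_set_scope.
Variable R : realType.

(* From [ln x < x] at [x = 1 / sqrt y]. *)
Lemma xlnx_bound (y : R) : 0 < y < 1 -> - (2 * Num.sqrt y) <= y * ln y <= 0.
Proof.
move=> /andP[y0 y1]; rewrite pmulr_rle0// (ln_le0 (ltW y1)) andbT.
set s := Num.sqrt y; have s0 : 0 < s by rewrite sqrtr_gt0.
have -> : y = s ^+ 2 by rewrite sqr_sqrtr// ltW.
rewrite lnXn// -[ln s]opprK -lnV ?posrE//.
have : s ^+ 2 * ln s^-1 <= s.
  rewrite [leRHS](_ : s = s ^+ 2 * s^-1); last by rewrite expr2 mulfK// gt_eqF.
  by rewrite ler_pM2l ?exprn_gt0// ltW// ln_sublinear// invr_gt0.
lra.
Qed.

(** The convention [ln 0 = 0], extended to negative arguments, makes the function vanish on the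
    left; at 0 it is squeezed by a square root. Continuity on the whole line permits arbitrary real
    weights below. *)
Lemma continuous_xlnx : continuous (fun y : R => y * ln y).
Proof.
move=> y; have [y0|y0|->] := ltgtP y 0.
- apply: (near_cst_continuous 0); near=> z; rewrite ln0 ?mulr0//.
  by apply: ltW; near: z; exact: lt_nbhsl.
- by apply: continuousM; [exact: cvg_id | exact: continuous_ln].
rewrite /continuous_at mul0r.
apply: (@squeeze_cvgr _ _ _ _ (fun z => - (2 * Num.sqrt z)) (fun=> 0)).
- near=> z.
  have [z0|z0] := leP z 0.
    by rewrite ln0// mulr0 lexx andbT oppr_le0 mulr_ge0// sqrtr_ge0.
  apply: xlnx_bound; rewrite z0/=; near: z.
  exact: lt_nbhsl.
- have : - (2 * Num.sqrt z) @[z --> (0 : R)] --> - (2 * Num.sqrt (0 : R)).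
    by apply: cvgN; apply: cvgM; [exact: cvg_cst | exact: sqrt_continuous].
  by rewrite sqrtr0 mulr0 oppr0.
- exact: cvg_cst.
Unshelve. all: by end_near.
Qed.

Lemma continuous_bigsum (T : topologicalType) (I : finType) (Q : pred I)
    (F : I -> T -> R) :
  (forall i, Q i -> continuous (F i)) -> continuous (fun x => \sum_(i | Q i) F i x).
Proof.
move=> cF x; apply: (@cvg_big _ _ +%R) => [|i Qi]; first exact: add_continuous.
exact: cF.
Qed.

Lemma continuous_subr (T : topologicalType) (f g : T -> R) :
  continuous f -> continuous g -> continuous (fun x => f x - g x).
Proof. by move=> cf cg x; exact: cvgB (cf x) (cg x). Qed.

Lemma continuous_minr (T : topologicalType) (f g : T -> R) :
  continuous f -> continuous g -> continuous (fun x => Num.min (f x) (g x)).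
Proof. by move=> cf cg x; exact: (@continuous_min R T f g x (cf x) (cg x)). Qed.

(** * Maximization over the probability simplex *)

Section Simplex.
Variable X : finType.

Definition row_fun (v : 'rV[R]_#|X|) (x : X) : R := v ord0 (enum_rank x).

Lemma continuous_row_fun x : continuous (fun v => row_fun v x).
Proof. exact: coord_continuous. Qed.

(** Extreme value theorem: inside row vectors the simplex is a closed part of a compact cube, and
    [px0] shows that it is nonempty. *)
Lemma fdist_max (F : (X -> R) -> R) (px0 : fdist R X) :
  continuous (fun v => F (row_fun v)) ->
  exists px : fdist R X, forall px' : fdist R X, F px' <= F px.
Proof.
move=> cF.
pose simplex := [set v : 'rV[R]_#|X| | forall i, `[0, 1] (v ord0 i)] `&`
  [set v | \sum_x row_fun v x = 1].
have simplex_fdist (px : fdist R X) : exists2 v, simplex v & row_fun v = px.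
  pose v : 'rV[R]_#|X| := \row_i px (enum_val i).
  have vE : row_fun v = px by apply/funext => x; rewrite /row_fun mxE enum_rankK.
  exists v => //; split => [i|] /=; last by rewrite vE pmf_sum1.
  rewrite mxE/= in_itv/= pmf_ge0/= -(pmf_sum1 px) (bigD1 (enum_val i))//= lerDl.
  by apply: sumr_ge0 => x _; exact: pmf_ge0.
have compact_simplex : compact simplex.
  apply: compact_closedI.
    exact: (@rV_compact R _ (fun=> `[0, 1]) (fun=> @segment_compact R 0 1)).
  apply: (@preimage_closed _ R (fun v => \sum_x row_fun v x) [set x | x = 1]);
    last exact: closed_eq.
  by move=> v _; apply: continuous_bigsum => x _; exact: continuous_row_fun.
have simplex0 : simplex !=set0.
  by have [v] := simplex_fdist px0; exists v.
have [c + c_max] := EVT_max_rV simplex0 compact_simplex (continuous_subspaceT cF).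
rewrite inE => -[c01 c_sum1].
have c_ge0 x : 0 <= row_fun c x.
  by have := c01 (enum_rank x); rewrite /= in_itv => /andP[].
exists (FDist c_ge0 c_sum1) => px'.
by have [v v_simplex <-] := simplex_fdist px'; apply: c_max; rewrite inE.
Qed.

End Simplex.

(** * Continuity of information in the input law *)

Section EntropyContinuity.
Variables (X U : finType) (q : X -> fdist R U).

(** Extends the entropy of [V] under [io_law] to unnormalized weights [w], so that it makes sense at
    every row vector. *)
Definition out_entropy (A : finType) (V : X * U -> A) (w : X -> R) : R :=
  - \sum_a (\sum_(t | V t == a) w t.1 * q t.1 t.2) *
      ln (\sum_(t | V t == a) w t.1 * q t.1 t.2).

(** Differences of entropies replace the quotients of laws, whose denominators may vanish on the
    boundary of the simplex. *)
Definition out_info (A B C : finType) (V : X * U -> A) (V' : X * U -> B)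
    (V'' : X * U -> C) (w : X -> R) : R :=
  out_entropy [% V, V''] w - out_entropy V'' w
  - (out_entropy [% V, [% V', V'']] w - out_entropy [% V', V''] w).

Lemma out_infoE (A B C : finType) (V : X * U -> A) (V' : X * U -> B)
    (V'' : X * U -> C) (px : fdist R X) :
  cond_mutual_info (io_law px q) V V' V'' = out_info V V' V'' px.
Proof. by rewrite /cond_mutual_info !cond_entropyB. Qed.

Lemma continuous_out_entropy (A : finType) (V : X * U -> A) :
  continuous (fun v => out_entropy V (row_fun v)).
Proof.
move=> v; apply: continuousN; apply: continuous_bigsum => a _ {}v.
apply: (@continuous_comp _ _ _ _ (fun y : R => y * ln y)); last exact: continuous_xlnx.
apply: continuous_bigsum => t _ {}v.
by apply: continuousM; [exact: continuous_row_fun | exact: cst_continuous].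
Qed.

Lemma continuous_out_info (A B C : finType) (V : X * U -> A) (V' : X * U -> B)
    (V'' : X * U -> C) : continuous (fun v => out_info V V' V'' (row_fun v)).
Proof.
by apply: continuous_subr; apply: continuous_subr; exact: continuous_out_entropy.
Qed.

End EntropyContinuity.

End Continuity.

Section Slack.
Variables (R : realType) (S1 S2 W W3 X1 X2 X3 Y Y3 : finType).
Variables (p : fdist R (S1 * S2 * W * W3)).
Variables (q : X1 * X2 * X3 -> fdist R (Y * Y3)).
Variable kappa : R.

Lemma slack_max (px0 : fdist R (X1 * X2 * X3)) :
  exists px, forall px', slack p q kappa px' <= slack p q kappa px.
Proof.
(* [F] extends [slack] from input laws to arbitrary weights. *)
pose F (w : X1 * X2 * X3 -> R) := Num.min
   (Num.min (kappa * out_info q [% inX1, inX3] outY inX2 w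
               - cond_entropy p srcS1 [% srcS2, srcW])
   (Num.min (kappa * out_info q [% inX2, inX3] outY inX1 w
               - cond_entropy p srcS2 [% srcS1, srcW])
            (kappa * out_info q [% inX1, inX2, inX3] outY (fun=> tt) w
               - cond_entropy p [% srcS1, srcS2] srcW)))
   (Num.min (kappa * out_info q inX1 outY3 [% inX2, inX3] w
               - cond_entropy p srcS1 [% srcS2, srcW3])
   (Num.min (kappa * out_info q inX2 outY3 [% inX1, inX3] w
               - cond_entropy p srcS2 [% srcS1, srcW3])
            (kappa * out_info q [% inX1, inX2] outY3 inX3 w
               - cond_entropy p [% srcS1, srcS2] srcW3))).
have FE px : slack p q kappa px = F px by rewrite /slack mutual_infoE !out_infoE.
have [|px px_max] := @fdist_max _ _ F px0.
  have cterm (A B C : finType) (V : X1 * X2 * X3 * (Y * Y3) -> A)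
      (V' : X1 * X2 * X3 * (Y * Y3) -> B) (V'' : X1 * X2 * X3 * (Y * Y3) -> C) (h : R) :
      continuous (fun v => kappa * out_info q V V' V'' (row_fun v) - h).
    apply: continuous_subr => v; last exact: cst_continuous.
    exact: cvgM (cvg_cst kappa) (@continuous_out_info _ _ _ q _ _ _ V V' V'' v).
  by rewrite /F; do !apply: continuous_minr; exact: cterm.
by exists px => px'; rewrite !FE.
Qed.

End Slack.

Theorem theorem3 (R : realType) (S1 S2 W W3 X1 X2 X3 Y Y3 : finType)
    (p : fdist R (S1 * S2 * W * W3))
    (q : X1 * X2 * X3 -> fdist R (Y * Y3))
    (X1_nonempty : (0 < #|X1|)%N)
    (X2_nonempty : (0 < #|X2|)%N)
    (X3_nonempty : (0 < #|X3|)%N)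
    (kappa : R) (kappa_ge0 : 0 <= kappa) :
  achievable p q kappa ->
  exists px : fdist R (X1 * X2 * X3),
    let P := io_law px q in
    [/\ cond_entropy p srcS1 [% srcS2, srcW]
          <= kappa * cond_mutual_info P [% inX1, inX3] outY inX2,
        cond_entropy p srcS2 [% srcS1, srcW]
          <= kappa * cond_mutual_info P [% inX2, inX3] outY inX1 &
        cond_entropy p [% srcS1, srcS2] srcW
          <= kappa * mutual_info P [% inX1, inX2, inX3] outY]
    /\
    [/\ cond_entropy p srcS1 [% srcS2, srcW3]
          <= kappa * cond_mutual_info P inX1 outY3 [% inX2, inX3],
        cond_entropy p srcS2 [% srcS1, srcW3]
          <= kappa * cond_mutual_info P inX2 outY3 [% inX1, inX3] &
        cond_entropy p [% srcS1, srcS2] srcW3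
          <= kappa * cond_mutual_info P [% inX1, inX2] outY3 inX3].
Proof.
move=> ach.
have approx := slack_achievable kappa_ge0 X1_nonempty X2_nonempty X3_nonempty ach.
(* The tolerance 1 is arbitrary: only the existence of an input law is extracted here. *)
have [px0 _] := approx 1 ltr01.
have [px px_max] := slack_max p q kappa px0.
have : 0 <= slack p q kappa px.
  (* The maximal slack is at least [- delta] for every positive [delta]. *)
  apply/ler_addgt0Pr => delta /approx[px' px'_slack].
  by rewrite -lerBlDr sub0r (le_trans px'_slack).
rewrite /slack !le_min !subr_ge0.
move=> /andP[/andP[c1 /andP[c2 c3]] /andP[c4 /andP[c5 c6]]].
by exists px.
Qed.
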